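(* Let $L$ be a complete lattice. If the set $Id(L)$ of all non-trivial ideals of $L$ is countable, then the Scott space $\Sigma L$ is sober.
   Context: A nonempty subset $D$ of a poset is directed if every two elements of $D$ have an upper bound in $D$. An ideal is a directed lower set. An ideal is non-trivial if it has no greatest element; $Id(L)$ denotes the set of all non-trivial ideals of $L$. A subset $U$ of a poset $L$ is Scott open if it is an upper set and, for every directed $D\subseteq L$ whose supremum exists with $\sup D\in U$, one has $D\cap U\neq\emptyset$. The Scott open sets form the Scott topology $\sigma(L)$, and $\Sigma L=(L,\sigma(L))$. A space is sober if it is $T_0$ and every irreducible closed subset is the closure of a (unique) point. *)

(* Defs.v *)
From HB Require Import structures.
From mathcomp Require Import all_boot all_order.
From mathcomp Require Import all_classical topology.

Set Implicit Arguments.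
Unset Strict Implicit.
Unset Printing Implicit Defensive.

Import Order.TTheory.
Local Open Scope classical_set_scope.
Local Open Scope order_scope.

Section Poset.
Context {d : Order.disp_t} {L : porderType d}.
Implicit Types (A D I U : set L).

Definition directed D :=
  D !=set0 /\ forall x y, D x -> D y -> exists2 z, D z & x <= z /\ y <= z.

Definition lower_set A := forall x y, x <= y -> A y -> A x.

Definition upper_set A := forall x y, x <= y -> A x -> A y.

Definition ideal I := directed I /\ lower_set I.

Definition has_greatest A := exists2 m, A m & ubound A m.

Definition nontrivial_ideal I := ideal I /\ ~ has_greatest I.

Definition scott_open U :=
  upper_set U /\
  forall D s, directed D -> supremums D s -> U s -> D `&` U !=set0.

End Poset.

Definition Id d (L : porderType d) : set (set L) :=
  [set I | nontrivial_ideal I].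
Arguments Id {d} L.

Definition complete_lattice d (L : porderType d) :=
  forall A : set L, supremums A !=set0 /\ infimums A !=set0.
Arguments complete_lattice {d} L.

(* Alias of L carrying the Scott topology. *)
Definition Sigma d (L : porderType d) : Type := L.

Section ScottTopology.
Context {d : Order.disp_t} {L : porderType d}.

HB.instance Definition _ := Order.POrder.on (Sigma L).

Let scott_openT : @scott_open d L setT.
Proof. by split=> // D s [[x Dx] _] _ _; exists x. Qed.

Let scott_openI (U V : set L) :
  scott_open U -> scott_open V -> scott_open (U `&` V).
Proof.
move=> [upU oU] [upV oV]; split=> [x y xy [Ux Vx]|D s dD sD [Us Vs]].
  by split; [apply: upU Ux | apply: upV Vx].
have [x [Dx Ux]] := oU _ _ dD sD Us; have [y [Dy Vy]] := oV _ _ dD sD Vs.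
have [z Dz [xz yz]] := dD.2 _ _ Dx Dy.
by exists z; split=> //; split; [apply: upU Ux | apply: upV Vy].
Qed.

Let scott_open_bigU (I : Type) (f : I -> set L) :
  (forall i, scott_open (f i)) -> scott_open (\bigcup_i f i).
Proof.
move=> of_; split=> [x y xy [i _ fx]|D s dD sD [i _ fs]].
  by exists i => //; apply: (of_ i).1 fx.
by have [x [Dx fx]] := (of_ i).2 _ _ dD sD fs; exists x; split=> //; exists i.
Qed.

HB.instance Definition _ := isOpenTopological.Build (Sigma L)
  scott_openT scott_openI scott_open_bigU.

End ScottTopology.

Lemma SigmaE d (L : porderType d) :
  (open : set (set (Sigma L))) = [set U : set L | scott_open U].
Proof. by []. Qed.

Section Sober.
Variable T : topologicalType.

Definition irreducible (C : set T) :=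
  C !=set0 /\ forall A B : set T, closed A -> closed B ->
    C `<=` A `|` B -> C `<=` A \/ C `<=` B.

Definition sober_space :=
  kolmogorov_space T /\
  forall C : set T, closed C -> irreducible C ->
    exists! x : T, C = closure [set x].

End Sober.
Arguments sober_space T : clear implicits.

(* Main.v *)
Require Import Defs.
From mathcomp Require Import all_boot all_order.
From mathcomp Require Import all_classical topology.

(** Call a relation [R] between posets with countably many non-trivial ideals
    separately Scott open if all its sections are.  Such an [R] is open in the
    product of the Scott topologies: starting from the rectangle of up-sets of
    [a] and [b], run through all non-trivial ideals infinitely often, and
    whenever the supremum of the current ideal lies in the current side, add to
    that side (the up-set of) one element of the ideal for which the rectangle
    still is contained in [R].  The union of the sides is Scott open because a
    directed set either has a greatest element or generates a non-trivial ideal.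
    For an irreducible closed [C] this applies to the relation "x \/ y is not
    in [C]"; it yields that [C] is closed under binary joins, so that [C] is the
    closure of its supremum. *)

Set Implicit Arguments.
Unset Strict Implicit.
Unset Printing Implicit Defensive.

Import Order.TTheory.
Local Open Scope classical_set_scope.
Local Open Scope order_scope.

Lemma countable_infinitely_often (T : Type) (x0 : T) (A : set T) :
  countable A ->
  exists e : nat -> T, forall x m, A x -> exists2 n, (m <= n)%N & e n = x.
Proof.
move=> /countable_injP[f injf].
have /choice[g gP] : forall k, exists x, forall y, A y -> f y = k -> x = y.
  move=> k; have [[x [Ax fx]]|no] := pselect (exists x, A x /\ f x = k).
    by exists x => y Ay fy; apply: injf; rewrite ?inE // fx fy.
  by exists x0 => y Ay fy; case: no; exists y.
(* The 2-adic valuation takes the value [f x] at all odd multiples of [2 ^ f x], hence at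
   arbitrarily large [n]. *)
exists (fun n => g (logn 2 n)) => x m Ax; exists (2 ^ f x * m.*2.+1)%N.
  apply: (@leq_trans (1 * m.*2.+1)%N); last by rewrite leq_pmul2r ?expn_gt0.
  by rewrite mul1n -addnn ltnW // ltnS leq_addr.
apply: gP => //; rewrite lognM ?expn_gt0 // pfactorK //.
by rewrite logn_coprime ?addn0 // coprime2n /= odd_double.
Qed.

(** * Scott openness and non-trivial ideals *)

Section Scott.
Context {d : Order.disp_t} {L : porderType d}.
Implicit Types (x y a : L) (D U V I E : set L).

Definition upset a : set L := [set x | a <= x].

Lemma upset_upper a : upper_set (upset a).
Proof. by move=> x y xy ax; apply: le_trans xy. Qed.

Lemma upper_setU U V : upper_set U -> upper_set V -> upper_set (U `|` V).
Proof. by move=> uU uV x y xy [/(uU _ _ xy)|/(uV _ _ xy)]; [left|right]. Qed.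

Lemma scott_openI U V : scott_open U -> scott_open V -> scott_open (U `&` V).
Proof. exact: (@openI (Sigma L)). Qed.

(** The lower closure [I] of a directed [D] is an ideal with the same supremum. If it has a greatest
    element, that is the supremum and lies below an element of [D]. *)
Lemma scott_open_nontrivial U : upper_set U ->
  (forall I s, nontrivial_ideal I -> supremums I s -> U s -> I `&` U !=set0) ->
  scott_open U.
Proof.
move=> uU idU; split=> // D s dD [ubs lubs] Us.
pose I := [set x | exists2 y, D y & x <= y].
have subI y : D y -> I y by exists y.
have supI : supremums I s.
  split=> [x [y Dy xy]|z ubz]; first exact: le_trans xy (ubs _ Dy).
  by apply: lubs => y /subI; apply: ubz.
have [[m [y Dy my] ubm]|ntI] := pselect (has_greatest I).
  exists y; split=> //; apply: uU Us; apply: le_trans my.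
  exact: supI.2.
have [|x [[y Dy xy] Ux]] := idU I s _ supI Us; last first.
  by exists y; split=> //; apply: uU Ux.
split=> //; split; last first.
  by move=> x y xy [z Dz yz]; exists z => //; apply: le_trans yz.
split; first by case: dD.1 => y /subI; exists y.
move=> x y [x' Dx' xx'] [y' Dy' yy'].
have [z Dz [x'z y'z]] := dD.2 _ _ Dx' Dy'.
by exists z; [exact: subI | split; [apply: le_trans x'z | apply: le_trans y'z]].
Qed.

End Scott.

(** * Rectangles inside a relation *)

Section Rectangle.
Context {d d' : Order.disp_t} {L : porderType d} {M : porderType d'}.
Implicit Types (R : L -> M -> Prop).

(** Half of the Galois connection of [R]: the rectangle of [E] and [F] lies in [R] iff [F] is
    contained in [polar R E]. *)
Definition polar R (E : set L) : set M := [set y | forall x, E x -> R x y].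

Lemma polar_upset R a : (forall y, upper_set (R^~ y)) -> polar R (upset a) = R a.
Proof.
move=> uR; apply/seteqP; split=> y; first by apply; exact: lexx.
by move=> Ray x ax; apply: uR Ray.
Qed.

Lemma polarU R E E' : polar R (E `|` E') = polar R E `&` polar R E'.
Proof.
apply/seteqP; split=> y; last by move=> [PE PE'] x [/PE|/PE'].
by move=> P; split=> x Ex; apply: P; [left|right].
Qed.

End Rectangle.

(* [open_rect R E F] strengthens [E `*` F `<=` R] to an invariant that survives
   the extension of either side by one principal up-set. *)
Definition open_rect d d' (L : porderType d) (M : porderType d')
    (R : L -> M -> Prop) (E : set L) (F : set M) :=
  [/\ upper_set E /\ upper_set F, E `<=` polar (fun y x => R x y) F,
      scott_open (polar R E) & scott_open (polar (fun y x => R x y) F)].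

Lemma open_rectC d d' (L : porderType d) (M : porderType d')
    (R : L -> M -> Prop) E F :
  open_rect R E F -> open_rect (fun y x => R x y) F E.
Proof. by move=> [[uE uF] EF oE oF]; split=> // y Fy x Ex; apply: EF. Qed.

(* If the supremum [s] of [I] is in [E], then [s] is in the Scott open polar of
   [F], hence so is some element of [I]. *)
Lemma open_rect_extend d d' (L : porderType d) (M : porderType d')
    (R : L -> M -> Prop) E F (I : set L) :
  (forall y, upper_set (R^~ y)) -> (forall x, scott_open (R x)) ->
  open_rect R E F ->
  exists E', [/\ open_rect R E' F, E `<=` E' &
    directed I -> forall s, supremums I s -> E s -> I `&` E' !=set0].
Proof.
move=> uR oR rEF; have [[uE uF] EF oE oF] := rEF.
have [[dI [s supI Es]]|no] :=
    pselect (directed I /\ exists2 s, supremums I s & E s); last first.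
  by exists E; split=> // dI s supI Es; case: no; split=> //; exists s.
have [x [Ix Fx]] := oF.2 _ _ dI supI (EF _ Es).
exists (E `|` upset x); split; last 2 first.
- by move=> z; left.
- by move=> _ _ _ _; exists x; split=> //; right; exact: lexx.
split=> //; first by split=> //; apply: upper_setU => //; exact: upset_upper.
  by rewrite subUset; split=> // z xz; apply: oF.1 Fx.
(* The new polar is the old one cut with the section [R x]. *)
by rewrite polarU polar_upset //; apply: scott_openI.
Qed.

Lemma separately_scott_open d d' (L : porderType d) (M : porderType d')
    (R : L -> M -> Prop) a b :
  countable (Id L) -> countable (Id M) ->
  (forall y, scott_open (R^~ y)) -> (forall x, scott_open (R x)) -> R a b ->
  exists V W, [/\ scott_open V, scott_open W, V a, W b &
    forall x y, V x -> W y -> R x y].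
Proof.
move=> /(countable_infinitely_often set0)[e eP].
move=> /(countable_infinitely_often set0)[e' e'P] oRl oRr Rab.
(* Conditional on the invariant, so that [step] can be chosen as a total function. *)
pose good (n : nat) (p q : set L * set M) :=
  open_rect R p.1 p.2 ->
  [/\ open_rect R q.1 q.2, p.1 `<=` q.1, p.2 `<=` q.2,
      directed (e n) ->
        forall s, supremums (e n) s -> p.1 s -> e n `&` q.1 !=set0 &
      directed (e' n) ->
        forall s, supremums (e' n) s -> p.2 s -> e' n `&` q.2 !=set0].
have /choice[step stepP] : forall np : nat * _, exists q, good np.1 np.2 q.
  move=> [n [E F]]; have [r|nr] := pselect (open_rect R E F); last first.
    by exists (E, F) => /nr.
  have [E' [/open_rectC r' EE' dE]] :=
    open_rect_extend (e n) (fun y => (oRl y).1) oRr r.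
  have [F' [/open_rectC r'' FF' dF]] :=
    open_rect_extend (e' n) (fun x => (oRr x).1) oRl r'.
  by exists (E', F').
pose p := fix p n : set L * set M :=
  if n is m.+1 then step (m, p m) else (upset a, upset b).
have rp n : open_rect R (p n).1 (p n).2.
  elim: n => [|n IH] /=; last by have [] := stepP (n, p n) IH.
  split; first by split; exact: upset_upper.
  - move=> x ax y yb; apply: (oRl _).1 (ax) _; exact: (oRr _).1 yb _.
  - by rewrite polar_upset // => y; exact: (oRl y).1.
  - by rewrite polar_upset // => x; exact: (oRr x).1.
have mono m n : (m <= n)%N -> (p m).1 `<=` (p n).1 /\ (p m).2 `<=` (p n).2.
  move=> /subnK <-; elim: (n - m)%N => [|k [IH1 IH2]]; first by split.
  have [_ s1 s2 _ _] := stepP ((k + m)%N, p (k + m)%N) (rp _).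
  by split; [exact: subset_trans IH1 s1 | exact: subset_trans IH2 s2].
exists (\bigcup_n (p n).1), (\bigcup_n (p n).2); split.
- apply: scott_open_nontrivial => [x y xy [n _ px]|I s ntI supI [m _ pms]].
    by exists n => //; have [[u _] _ _ _] := rp n; apply: u px.
  (* [I] recurs at a stage [n] where [s] is already present; after that step the side meets [I]. *)
  have [n mn enI] := eP I m ntI.
  have [_ _ _ + _] := stepP (n, p n) (rp n); rewrite /= enI.
  move=> /(_ ntI.1.1 s supI ((mono _ _ mn).1 _ pms))[x [Ix qx]].
  by exists x; split=> //; exists n.+1.
- apply: scott_open_nontrivial => [x y xy [n _ px]|I s ntI supI [m _ pms]].
    by exists n => //; have [[_ u] _ _ _] := rp n; apply: u px.
  have [n mn enI] := e'P I m ntI.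
  have [_ _ _ _] := stepP (n, p n) (rp n); rewrite /= enI.
  move=> /(_ ntI.1.1 s supI ((mono _ _ mn).2 _ pms))[x [Ix qx]].
  by exists x; split=> //; exists n.+1.
- by exists 0%N => //=; exact: lexx.
- by exists 0%N => //=; exact: lexx.
move=> x y [m _ px] [n _ py].
have [_ sub _ _] := rp (maxn m n).
by apply: sub; [exact: (mono _ _ (leq_maxl m n)).1
               | exact: (mono _ _ (leq_maxr m n)).2].
Qed.

(** * Scott continuity of joins *)

Section CompleteLattice.
Context {d : Order.disp_t} {L : porderType d}.
Hypothesis cL : complete_lattice L.
Implicit Types (U : set L) (x y : L).

(* Every upper bound of [x] and [y], equivalently their join, is in [U]. *)
Definition join_in U x y := forall z, x <= z -> y <= z -> U z.

Lemma join_inC U x y : join_in U x y -> join_in U y x.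
Proof. by move=> J z yz xz; apply: J. Qed.

(** The joins of [y] with the elements of [D] form a directed set [D'] whose supremum is the join of
    [y] and [s], so one of them lies in [U]. *)
Lemma scott_open_join_in U y : scott_open U -> scott_open (join_in U ^~ y).
Proof.
move=> [uU oU]; split=> [x x' xx' J z x'z yz|D s dD supD Jsy].
  by apply: J => //; apply: le_trans x'z.
have joinP x : exists j, [/\ x <= j, y <= j &
    forall z, x <= z -> y <= z -> j <= z].
  have [[j [ub lub]] _] := cL [set x; y].
  exists j; split; [by apply: ub; left | by apply: ub; right | ].
  by move=> z xz yz; apply: lub => _ [->|->].
pose D' := [set t | exists x, [/\ D x, x <= t, y <= t &
  forall z, x <= z -> y <= z -> t <= z]].
have D'P x : D x -> exists t, [/\ D' t, x <= t & y <= t].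
  move=> Dx; have [t [xt yt tP]] := joinP x.
  by exists t; split=> //; exists x.
have dD' : directed D'.
  split; first by have [x /D'P[t []]] := dD.1; exists t.
  move=> t1 t2 [x1 [Dx1 _ _ t1P]] [x2 [Dx2 _ _ t2P]].
  have [x Dx [x1x x2x]] := dD.2 _ _ Dx1 Dx2.
  have [t [D't xt yt]] := D'P _ Dx; exists t => //.
  by split; [apply: t1P | apply: t2P] => //; apply: le_trans xt.
have [j [sj yj jP]] := joinP s.
have supD' : supremums D' j.
  split=> [t [x [Dx _ _ tP]]|z ubz].
    by apply: tP => //; apply: le_trans sj; apply: supD.1.
  apply: jP.
    apply: supD.2 => x /D'P[t [D't xt _]]; apply: le_trans xt _; exact: ubz.
  have [x /D'P[t [D't _ yt]]] := dD.1; apply: le_trans yt _; exact: ubz.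
have [t [[x [Dx _ _ tP]] Ut]] := oU _ _ dD' supD' (Jsy _ sj yj).
by exists x; split=> // z xz yz; apply: uU Ut; apply: tP.
Qed.

End CompleteLattice.

(** * Point closures and separation *)

Section Closure.
Context {d : Order.disp_t} {L : porderType d}.

Lemma closed_lower (C : set (Sigma L)) : closed C -> lower_set (C : set L).
Proof.
move=> /closed_openC[uC _] x y xy Cy; apply: contrapT => /(uC _ _ xy); exact.
Qed.

Lemma closed_downset (x : L) : closed ([set y | y <= x] : set (Sigma L)).
Proof.
rewrite -openC; split=> [y z yz + zx|D s dD [_ lub] nsx].
  by apply; apply: le_trans zx.
apply: contrapT => no; apply: nsx; apply: lub => y Dy.
by apply: contrapT => nyx; apply: no; exists y.
Qed.

Lemma closure_downset (x : Sigma L) :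
  closure [set x] = [set y : L | y <= (x : L)].
Proof.
apply/seteqP; split.
  have /closure_id -> := @closed_downset x.
  by apply: closureS => _ ->; exact: (@lexx _ L).
move=> y yx; have lower := closed_lower (@closed_closure (Sigma L) [set x]).
by apply: lower yx _; exact: subset_closure.
Qed.

(** Of two distinct points one is not below the other; the complement of the down-set of the latter
    separates them. *)
Lemma kolmogorov_Sigma : kolmogorov_space (Sigma L).
Proof.
move=> x y xy.
have nbhsC (u v : L) : ~ u <= v -> nbhs (u : Sigma L) (~` [set z : L | z <= v]).
  move=> nuv; apply: open_nbhs_nbhs; split=> //.
  by apply: closed_openC; exact: closed_downset.
have notC (u : L) : (~` ~` [set z : L | z <= u]) u by apply; exact: lexx.
have [le_xy|nxy] := pselect ((x : L) <= y).
  exists (~` [set z : L | z <= (x : L)]); right; rewrite !inE; split; last exact: notC.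
  apply: nbhsC => le_yx; move/eqP: xy; apply.
  by apply/le_anti/andP.
exists (~` [set z : L | z <= (y : L)]); left; rewrite !inE; split; last exact: notC.
exact: nbhsC.
Qed.

End Closure.

(** * Irreducible closed sets and sobriety *)

Lemma irreducible_open_meet (T : topologicalType) (C U V : set T) :
  irreducible C -> open U -> open V -> C `&` U !=set0 -> C `&` V !=set0 ->
  C `&` (U `&` V) !=set0.
Proof.
move=> [_ irrC] oU oV [x [Cx Ux]] [y [Cy Vy]]; apply: contrapT => no.
have [||z Cz|/(_ x Cx)|/(_ y Cy)] // := irrC (~` U) (~` V).
- exact: open_closedC.
- exact: open_closedC.
- by rewrite -setCI => UVz; apply: no; exists z.
Qed.

Theorem theorem3p5 (d : Order.disp_t) (L : porderType d)
    (cL : complete_lattice L) (cId : countable (Id L)) :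
  sober_space (Sigma L).
Proof.
split; first exact: kolmogorov_Sigma.
move=> C clC irrC; have oC : scott_open (~` C : set L) := closed_openC clC.
have lC := closed_lower clC.
have dC : directed (C : set L).
  split=> [|a b Ca Cb]; first exact: irrC.1.
  apply: contrapT => no.
  have Jab : join_in (~` C) a b by move=> z az bz Cz; apply: no; exists z.
  have oJl y : scott_open ((join_in (~` C))^~ y) by exact: scott_open_join_in.
  have oJr x : scott_open (join_in (~` C) x).
    rewrite (_ : join_in _ x = (join_in (~` C))^~ x) //.
    by apply/seteqP; split=> y; exact: join_inC.
  have [V [W [oV oW Va Wb VW]]] := separately_scott_open cId cId oJl oJr Jab.
  (* The relation at the pair [c], [c] puts [c], its own join with itself, outside [C]. *)
  have [||c [Cc [Vc Wc]]] := @irreducible_open_meet _ C V W irrC oV oW.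
  - by exists a.
  - by exists b.
  by apply: (VW c c Vc Wc c).
have [[s supC] _] := cL C.
have Cs : C s.
  (* Otherwise the Scott open complement of [C] would meet the directed set [C]. *)
  apply: contrapT => nCs.
  by have [x [Cx nCx]] := oC.2 _ _ dC supC nCs; apply: nCx.
have Cdown : C = [set y : L | y <= s].
  apply/seteqP; split=> y; first exact: supC.1.
  by move=> ys; exact: lC ys Cs.
exists s; split; first by rewrite closure_downset.
move=> t; rewrite closure_downset Cdown => /seteqP[st ts].
by apply/le_anti/andP; split; [apply: st | apply: ts]; exact: lexx.
Qed.
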